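(* Let $\mathbf{F}(\alpha)/\mathbf{F}$ be a simple field extension ($\alpha$ may be algebraic or transcendental over $\mathbf{F}$), and let $H$ be a subgroup of the group $\mathrm{Gal}(\mathbf{F}(\alpha)/\mathbf{F})$. Suppose that the $H$-orbit of $\alpha$ is finite, say $\mathcal{O}_H(\alpha)=\{\alpha_1,\alpha_2,\dots,\alpha_n\}$ with $\alpha_1,\dots,\alpha_n$ distinct. Then the fixed field $\mathbf{F}(\alpha)^H$ coincides with $$\mathbf{F}\bigl(\varepsilon_1(\alpha_1,\dots,\alpha_n),\dots,\varepsilon_n(\alpha_1,\dots,\alpha_n)\bigr),$$ where $\varepsilon_i$, $1\le i\le n$, denotes the $i$th elementary symmetric polynomial in $n$ variables.
   Context: For a field extension $\mathbf{E}/\mathbf{F}$ (not assumed algebraic), $\mathrm{Gal}(\mathbf{E}/\mathbf{F})$ denotes the group of all field automorphisms of $\mathbf{E}$ that fix every element of $\mathbf{F}$. For a subgroup $H$ of it, $\mathbf{E}^H=\{\beta\in\mathbf{E}\mid\sigma(\beta)=\beta\text{ for all }\sigma\in H\}$, and the $H$-orbit of $\alpha\in\mathbf{E}$ is $\mathcal{O}_H(\alpha)=\{\sigma(\alpha)\mid\sigma\in H\}$. *)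

(* Defs.v *)
From HB Require Import structures.
From mathcomp Require Import all_boot all_algebra.
From mathcomp Require Import boolp classical_sets.
From mathcomp Require Import mpoly.

Set Implicit Arguments.
Unset Strict Implicit.
Unset Printing Implicit Defensive.

Import GRing.Theory.
Local Open Scope ring_scope.
Local Open Scope classical_set_scope.

(* A field extension E / F is a field morphism iota : F -> E; neither
   algebraicity nor finite dimension is assumed, hence no fieldExtType. *)

Section Adjoin.
Variables (F E : fieldType) (iota : {rmorphism F -> E}).

(* F(S), the smallest subfield of E that contains F and S *)
Definition adjoin (S : set E) : set E :=
  smallest (fun K : set E => divring_closed (mem K)) (range iota `|` S).

End Adjoin.

Section Galois.
Variables (F E : fieldType) (iota : {rmorphism F -> E}).

Record gal := Gal {
  gal_fun :> E -> E;
  gal_zmod_morphism : zmod_morphism gal_fun;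
  gal_monoid_morphism : monoid_morphism gal_fun;
  gal_bij : bijective gal_fun;
  gal_fix : forall c : F, gal_fun (iota c) = iota c
}.

HB.instance Definition _ := gen_eqMixin gal.
HB.instance Definition _ := gen_choiceMixin gal.

HB.instance Definition _ (s : gal) :=
  GRing.isZmodMorphism.Build E E (gal_fun s) (gal_zmod_morphism s).
HB.instance Definition _ (s : gal) :=
  GRing.isMonoidMorphism.Build E E (gal_fun s) (gal_monoid_morphism s).

Lemma galP (s t : gal) : s =1 t -> s = t.
Proof.
case: s t => [f fa fm fb ff] [g ga gm gb gf] /= /funext fg.
by subst g; congr Gal; apply: Prop_irrelevance.
Qed.

Definition gal_one : gal.
Proof.
by exists (fun x => x) => //; exists id.
Defined.

Definition gal_mul (s t : gal) : gal.
Proof.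
exists (fun x => s (t x)).
- by move=> x y; rewrite !rmorphB.
- by split=> [|x y]; rewrite ?rmorph1 ?rmorphM.
- exact: bij_comp (gal_bij s) (gal_bij t).
- by move=> c; rewrite !gal_fix.
Defined.

Lemma gal_inv_subproof (s : gal) :
  exists t : gal, cancel s t /\ cancel t s.
Proof.
have [g sK gK] := gal_bij s.
have gB : zmod_morphism g.
  by move=> x y; apply: (can_inj sK); rewrite rmorphB /= !gK.
have gM : monoid_morphism g.
  split=> [|x y]; apply: (can_inj sK).
    by rewrite gK rmorph1.
  by rewrite rmorphM /= !gK.
have gF c : g (iota c) = iota c by rewrite -[in LHS](gal_fix s) sK.
by exists (Gal gB gM (Bijective gK sK) gF); split.
Qed.

Definition gal_inv (s : gal) : gal := projT1 (cid (gal_inv_subproof s)).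

Lemma gal_invK (s : gal) : cancel s (gal_inv s) /\ cancel (gal_inv s) s.
Proof. exact: projT2 (cid (gal_inv_subproof s)). Qed.

Lemma gal_mulA : associative gal_mul.
Proof. by move=> s t u; apply: galP. Qed.

Lemma gal_mul1g : left_id gal_one gal_mul.
Proof. by move=> s; apply: galP. Qed.

Lemma gal_mulg1 : right_id gal_one gal_mul.
Proof. by move=> s; apply: galP. Qed.

Lemma gal_mulVg : left_inverse gal_one gal_inv gal_mul.
Proof. by move=> s; apply: galP => x /=; rewrite (gal_invK s).1. Qed.

Lemma gal_mulgV : right_inverse gal_one gal_inv gal_mul.
Proof. by move=> s; apply: galP => x /=; rewrite (gal_invK s).2. Qed.

(* (s * t)%g x = s (t x), as opposed to the left-to-right product of {perm T} *)
HB.instance Definition _ := isGroup.Build gal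
  gal_mulA gal_mul1g gal_mulg1 gal_mulVg gal_mulgV.

Definition fixed_field (H : set gal) : set E :=
  [set b | forall s : gal, H s -> s b = b].

Definition galorbit (H : set gal) (a : E) : set E := [set s a | s in H].

End Galois.

(* Main.v *)
Require Import Defs.
From HB Require Import structures.
From mathcomp Require Import all_boot all_algebra.
From mathcomp Require Import boolp classical_sets.
From mathcomp Require Import mpoly.

Set Implicit Arguments.
Unset Strict Implicit.
Unset Printing Implicit Defensive.

Import GRing.Theory.
Local Open Scope ring_scope.
Local Open Scope classical_set_scope.

(** Let [f] be the product of the [X - a i]; its coefficients are, up to sign,
    the elementary symmetric functions of the orbit, and they generate a field
    [K]. An element of [H] permutes the orbit, hence fixes [f], and this gives
    one inclusion. Conversely, write a fixed element as
    [b = p(alpha) / q(alpha)] with [p] and [q] over [F], and let [p'], [q'] be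
    the remainders of [p], [q] modulo [f]; they have coefficients in [K].
    Applying [H] to [p'(alpha) = b q'(alpha)] shows that [p' - b q'], of degree
    less than [n], vanishes at the [n] points [a i]. So [p' = b q'], and [b] is
    a quotient of two coefficients, hence in [K]. *)

Section Adjunction.
Variables (F E : fieldType) (iota : {rmorphism F -> E}).

Lemma adjoin_divring_closed (S : set E) :
  GRing.divring_closed (mem (adjoin iota S)).
Proof.
split=> [|x y|x y]; rewrite !inE /adjoin /smallest /=.
- by move=> A [[A1 _ _] _]; move: A1; rewrite inE.
- move=> Kx Ky A hA; case: (hA) => -[_ AB _] _.
  by have := AB x y; rewrite !inE; apply; [apply: Kx|apply: Ky].
- move=> Kx Ky A hA; case: (hA) => -[_ _ AD] _.
  by have := AD x y; rewrite !inE; apply; [apply: Kx|apply: Ky].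
Qed.

Lemma adjoin_base (S : set E) c : adjoin iota S (iota c).
Proof. by apply: sub_gen_smallest; left; exists c. Qed.

Lemma adjoin_gen (S : set E) : S `<=` adjoin iota S.
Proof. by move=> x Sx; apply: sub_gen_smallest; right. Qed.

(** Such fractions form a subfield containing [F] and [x], so minimality of [adjoin] applies.
    Nothing depends on whether [x] is algebraic or transcendental. *)
Lemma adjoin1_fraction (x b : E) : adjoin iota [set x] b ->
  exists p q : {poly F}, (map_poly iota q).[x] != 0 /\
    b = (map_poly iota p).[x] / (map_poly iota q).[x].
Proof.
pose ev p := (map_poly iota p).[x].
have evM p q : ev (p * q) = ev p * ev q by rewrite /ev rmorphM hornerM.
have evB p q : ev (p - q) = ev p - ev q.
  by rewrite /ev rmorphB hornerD hornerN.
have evC c : ev c%:P = iota c by rewrite /ev map_polyC hornerC.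
pose fractions : set E :=
  [set b | exists p q, ev q != 0 /\ b = ev p / ev q].
move: b; apply: (@smallest_sub _ _ _ fractions); last first.
  move=> y [[c _ <-]|->].
    by exists c%:P, 1%:P; rewrite !evC rmorph1 divr1 oner_neq0.
  exists 'X, 1%:P; rewrite !evC rmorph1 divr1 oner_neq0.
  by rewrite /ev map_polyX hornerX.
split=> [|y z|y z]; rewrite !inE.
- by exists 1%:P, 1%:P; rewrite !evC rmorph1 divr1 oner_neq0.
- move=> [p [q [q0 ->]]] [p' [q' [q'0 ->]]].
  exists (p * q' - p' * q), (q * q').
  by rewrite evB !evM mulf_neq0 //; split=> //; rewrite -mulNr addf_div // mulNr.
- move=> [p [q [q0 ->]]] [p' [q' [q'0 ->]]].
  (* Closure under division includes a zero divisor, for which the quotient is 0 by convention. *)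
  have [p'0|p'0] := eqVneq (ev p') 0.
    exists 0%:P, 1%:P.
    by rewrite !evC rmorph0 rmorph1 p'0 !mul0r invr0 mulr0 oner_neq0.
  exists (p * q'), (q * p').
  by rewrite !evM mulf_neq0 //; split=> //; rewrite invf_div mulf_div.
Qed.

End Adjunction.

(** Dividing by a monic polynomial uses only ring operations on coefficients, so the remainder stays
    over [S]. The induction follows Horner's scheme, and the remainder is recorded only through its
    values at the roots of [f]. *)
Lemma monic_remainder_polyOver (R : comNzRingType) (S : subringClosed R)
    (f p : {poly R}) :
    f \is monic -> f \is a polyOver S -> p \is a polyOver S ->
  exists2 r, r \is a polyOver S &
    (size r < size f)%N /\ (forall x, root f x -> r.[x] = p.[x]).
Proof.
move=> f_monic Sf; have f_gt0: (0 < size f)%N.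
  by rewrite size_poly_gt0 monic_neq0.
elim/poly_ind: p => [_|p c IHp Sp].
  by exists 0; rewrite ?rpred0 ?size_poly0.
have Sc : c \in S by have := polyOverP Sp 0%N; rewrite coefD coefMX coefC add0r.
have {IHp}[|r Sr [ltrf rp]] := IHp.
  apply/polyOverP=> i.
  by have := polyOverP Sp i.+1; rewrite coefD coefMX coefC addr0.
pose r1 := r * 'X + c%:P.
have Sr1 : r1 \is a polyOver S.
  by rewrite rpredD ?rpredM ?polyOverX ?polyOverC.
(* [r1] has size at most [size f], so one multiple of the monic [f] cancels the only excess
   coefficient. *)
exists (r1 - r1`_(size f).-1 *: f).
  by rewrite rpredB // polyOverZ // (polyOverP Sr1).
split=> [|x fx0]; last first.
  by rewrite hornerD hornerN hornerZ (rootP fx0) mulr0 subr0 /r1 !hornerMXaddC rp.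
rewrite -{2}(prednK f_gt0) ltnS; apply/leq_sizeP=> j.
rewrite leq_eqVlt => /predU1P[<-|ltj]; rewrite coefB coefZ.
  by rewrite -lead_coefE (monicP f_monic) mulr1 subrr.
have lefj : (size f <= j)%N by rewrite -(prednK f_gt0).
rewrite [f`_j]nth_default // mulr0 subr0 coefD coefMX coefC.
case: j ltj lefj => // j _ lefj.
by rewrite addr0 nth_default // -ltnS (leq_trans ltrf).
Qed.

(** Vieta's formulas, with the sign moved across since it squares to 1. *)
Lemma meval_mesym_coef (R : idomainType) n (a : 'I_n -> R) k : (k <= n)%N ->
  (mesym n R k).@[a] = (-1) ^+ k * (\prod_i ('X - (a i)%:P))`_(n - k).
Proof.
move=> lekn; have := mroots_coeff (mktuple a) (Ordinal (lekn : (k < n.+1)%N)).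
rewrite /= big_map enumT => ->; rewrite signrMK.
by apply: meval_eq => i; rewrite tnth_mktuple.
Qed.

Section FixedField.
Variables (F E : fieldType) (iota : {rmorphism F -> E}).
Variables (H : set (gal iota)) (H_subgroup : group_closed (mem H)).

Lemma fixed_field_divring_closed : GRing.divring_closed (mem (fixed_field H)).
Proof.
split=> [|x y|x y]; rewrite !inE.
- by move=> s _; rewrite rmorph1.
- by move=> Hx Hy s Hs; rewrite rmorphB /= Hx ?Hy.
- by move=> Hx Hy s Hs; rewrite fmorph_div /= Hx ?Hy.
Qed.

Lemma galorbit_stable (x y : E) (s : gal iota) :
  H s -> galorbit H x y -> galorbit H x (s y).
Proof.
move=> Hs [t Ht <-]; exists (s * t)%g => //.
by have := group_closedM H_subgroup; move/(_ s t); rewrite !inE; apply.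
Qed.

Lemma galorbit_refl (x : E) : galorbit H x x.
Proof. by exists 1%g => //; have [] := H_subgroup; rewrite inE. Qed.

End FixedField.

Theorem proposition6p1 (F E : fieldType) (iota : {rmorphism F -> E})
    (alpha : E) (E_gen : adjoin iota [set alpha] = [set: E])
    (H : set (gal iota)) (H_subgroup : group_closed (mem H))
    (n : nat) (a : 'I_n -> E) (a_inj : injective a)
    (orbitH : galorbit H alpha = range a) :
  fixed_field H =
    adjoin iota [set (mesym n E i.+1).@[a] | i in [set: 'I_n]].
Proof.
set K := adjoin _ _; pose f := \prod_i ('X - (a i)%:P).
have f_monic : f \is monic by apply: monic_prod_XsubC.
have size_f : size f = n.+1.
  by rewrite size_prod_XsubC /index_enum -enumT size_enum_ord.
have root_f i : root f (a i).
  by rewrite /f (bigD1 i) //= rootM root_XsubC eqxx.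
apply/seteqP; split; last first.
  apply: smallest_sub; first exact: fixed_field_divring_closed.
  move=> _ [[c _ <-]|[i _ <-]] s Hs; first exact: gal_fix.
  rewrite meval_mesym_coef // rmorphM rmorphXn rmorphN1 /= -/f; congr (_ * _).
  rewrite -coef_map; congr ((polyseq _)`_ _).
  have s_orbit j : exists k, s (a j) = a k.
    have : galorbit H alpha (s (a j)).
      by apply: galorbit_stable => //; rewrite orbitH; exists j.
    by rewrite orbitH => -[k _ <-]; exists k.
  (* The index map [g] is injective on a finite type, hence a permutation, and the product can be
     reindexed along it. *)
  have [g sa] := choice s_orbit.
  have g_inj : injective g.
    by move=> j k gjk; apply/a_inj/(fmorph_inj s); rewrite /= !sa gjk.
  rewrite /f rmorph_prod [RHS](reindex_inj g_inj) /=; apply: eq_bigr => j _.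
  by rewrite rmorphB /= map_polyX map_polyC /= sa.
have K_closed : GRing.divring_closed (mem K) := adjoin_divring_closed _ _.
pose KS : divringClosed E :=
  HB.pack (mem K : {pred E}) (GRing.isDivringClosed.Build E (mem K) K_closed).
have KSE x : (x \in KS) = (x \in K) by [].
have Kf : f \is a polyOver KS.
  apply/polyOverP=> j; have [ltnj|lejn] := ltnP n j.
    by rewrite nth_default ?rpred0 // size_f.
  have := meval_mesym_coef a (leq_subr j n); rewrite subKn // -/f.
  move/(congr1 (fun z => (-1) ^+ (n - j) * z)); rewrite signrMK => <-.
  rewrite rpredM ?rpredX ?rpredN ?rpred1 //.
  (* The generators start at degree 1; degree 0 corresponds to the leading coefficient 1 of [f]. *)
  case def_k: (n - j)%N => [|k]; first by rewrite mesym0E meval1 rpred1.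
  have ltkn : (k < n)%N by rewrite -def_k leq_subr.
  rewrite KSE inE; apply: adjoin_gen.
  by exists (Ordinal ltkn).
have remK (p : {poly F}) : exists2 r, r \is a polyOver KS &
    (size r <= n)%N /\ forall i, r.[a i] = (map_poly iota p).[a i].
  have [|r Kr [ltr rp]] :=
      monic_remainder_polyOver (S := KS) (p := map_poly iota p) f_monic Kf.
    apply/polyOverP=> i; rewrite coef_map KSE inE; exact: adjoin_base.
  by exists r => //; split=> [|i]; [rewrite size_f in ltr | apply: rp].
have [i0 _ a_i0] : range a alpha by rewrite -orbitH; apply: galorbit_refl.
move=> b fix_b; have [p [q [q0 def_b]]] : exists p q : {poly F},
    (map_poly iota q).[alpha] != 0 /\
      b = (map_poly iota p).[alpha] / (map_poly iota q).[alpha].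
  by apply: adjoin1_fraction; rewrite E_gen.
have [p' Kp' [size_p' p'E]] := remK p; have [q' Kq' [size_q' q'E]] := remK q.
have rel_orbit i : p'.[a i] = b * q'.[a i].
  have [s Hs sa] : galorbit H alpha (a i) by rewrite orbitH; exists i.
  (* As [s] fixes [F], it commutes with evaluation of polynomials over [F]. *)
  have sev (r : {poly F}) :
      (map_poly iota r).[s alpha] = s (map_poly iota r).[alpha].
    rewrite -[RHS]horner_map /= -map_poly_comp; congr _.[_].
    by apply: eq_map_poly => c /=; rewrite gal_fix.
  by rewrite p'E q'E -sa !sev -{1}(fix_b s Hs) -rmorphM /= def_b divfK.
have def_p' : p' = b *: q'.
  apply/eqP; rewrite -subr_eq0; apply/negPn/negP=> nz.
  have := max_poly_roots nz _ (_ : uniq (map a (enum 'I_n))).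
  rewrite map_inj_uniq // enum_uniq size_map size_enum_ord ltnNge.
  rewrite (leq_trans (size_polyD _ _)) ?geq_max ?size_p' ?size_polyN /=; last first.
    exact: leq_trans (size_scale_leq _ _) size_q'.
  move=> h; suff /h/(_ isT) : all (root (p' - b *: q')) (map a (enum 'I_n)) by [].
  apply/allP=> _ /mapP[i _ ->].
  by rewrite /root hornerD hornerN hornerZ rel_orbit subrr.
(* Since [alpha] is itself one of the [a i], [q'] takes there the nonzero value of [q]. So [q'] is
   nonzero, and comparing leading coefficients in [def_p'] gives [b] as a quotient. *)
have lc0 : lead_coef q' != 0.
  rewrite lead_coef_eq0; apply: contraNneq q0 => q'0.
  by rewrite -a_i0 -q'E q'0 horner0.
have : b \in KS.
  rewrite -(mulfK lc0 b) -lead_coefZ -def_p'.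
  by rewrite rpred_div // (polyOverP _).
by rewrite KSE inE.
Qed.
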